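(* Let $c$ and $d$ be integers. (i) Suppose $1<d<c-1$. Let $a,b\in\mathbb{Z}_c$, at least one of which is coprime with $c$, be such that the scales $A=\{0,a,2a,\dots,(d-1)a\}$ and $B=\{0,b,2b,\dots,(d-1)b\}$ in $\mathbb{Z}_c$ each have $d$ elements. If $A=B+\tau$ for some $\tau\in\mathbb{Z}_c$, then $a=b$ or $a=-b$ in $\mathbb{Z}_c$. In other words, if a scale with $d$ elements is generated by some $a$ coprime with $c$, then its only generators are $a$ and $-a$. (ii) Suppose $d>1$ and $d=c-1$ or $d=c$. Then a scale with $d$ elements in $\mathbb{Z}_c$ which is generated by an element coprime with $c$ has exactly $\Phi(c)$ generators.
   Context: $\mathbb{Z}_c=\mathbb{Z}/c\mathbb{Z}$ is the cyclic group with $c$ elements; an element of $\mathbb{Z}_c$ is coprime with $c$ if any integer representing it is. $\Phi$ is Euler's totient function. A scale is a subset of $\mathbb{Z}_c$. A scale $A$ with $d$ elements is generated by $f\in\mathbb{Z}_c$ (and $f$ is a generator of $A$) if $A=\{a_0,a_0+f,a_0+2f,\dots,a_0+(d-1)f\}$ for some starting point $a_0\in A$. *)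

(* Defs.v *)
From mathcomp Require Import all_boot all_order all_algebra.

Set Implicit Arguments.
Unset Strict Implicit.
Unset Printing Implicit Defensive.

Import GRing.Theory.
Local Open Scope ring_scope.

(* 'Z_c is Z/cZ only for 1 < c (it is Z/2Z when c is 0 or 1); this file is
   meant to be used under hypotheses that imply 1 < c.  A scale is a
   term of type {set 'Z_c}. *)

Definition coprime_elt (c : nat) (x : 'Z_c) : Prop :=
  forall n : int, n%:~R = x -> coprimez n c.

(* {a0, a0 + f, ..., a0 + (d-1) f}; it may have fewer than d elements. *)
Definition progression (c : nat) (a0 f : 'Z_c) (d : nat) : {set 'Z_c} :=
  [set a0 + f *+ i | i : 'I_d].

Definition translate (c : nat) (A : {set 'Z_c}) (tau : 'Z_c) : {set 'Z_c} :=
  [set x + tau | x in A].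

(* The length of the progression is the cardinality of the scale. *)
Definition generated_by (c : nat) (A : {set 'Z_c}) (f : 'Z_c) : bool :=
  [exists a0 in A, A == progression a0 f #|A|].

Definition generators (c : nat) (A : {set 'Z_c}) : {set 'Z_c} :=
  [set f | generated_by A f].

(* Main.v *)
Require Import Defs.
From mathcomp Require Import all_boot all_order all_algebra.
From mathcomp Require Import zify.

Import GRing.Theory.
Local Open Scope ring_scope.

(** The proof compares a scale with its translates.  If [A] is a progression of
    step [b], then translating [A] by [b] pushes at most one point out of [A],
    namely the successor of its last term.  On the other hand, if [A] is also a
    progression of length [d] whose step [a] is a unit, then multiples of [a]
    parametrize the whole circle, [b] is [a *+ t] for some [t < c], and [A] is
    an arc of [d] consecutive points; translating an arc by [t] steps pushes at
    least two points out of it as soon as the arc and its complement have at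
    least two points and [t] is none of [0], [1], [c - 1].  Hence [b] is [0],
    [a] or [- a] ([generator_of_arc]), and [0] is excluded since a progression
    of step [0] is a single point.  Only [a] has to be a unit, which is why
    (i) asks this of just one of the two steps.

    For (ii), the generators of a scale [A] with at least [c - 1] points are
    exactly the units ([generators_large]).  A non-unit has additive order at
    most [c / 2], so that its progressions have too few points
    ([unit_of_card_progression]).  Conversely a unit [f] generates [A] because
    [A] is the whole circle or misses one point [z], and in the latter case the
    progression of step [f] that starts just after [z] goes through everything
    else before returning to [z]. *)

Lemma coprime_elt_unit (c : nat) (a : 'Z_c) :
  (1 < c)%N -> coprime_elt a -> a \is a GRing.unit.
Proof.
move=> c1 /(_ (Posz a)); rewrite -pmulrn natr_Zp => /(_ erefl).
by rewrite coprimezE /= coprime_sym -{2}(natr_Zp a) unitZpE.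
Qed.

Lemma unit_mulrn_inj (c : nat) (a : 'Z_c) (i j : nat) :
    (1 < c)%N -> a \is a GRing.unit -> (i < c)%N -> (j < c)%N ->
  a *+ i = a *+ j -> i = j.
Proof.
move=> c1 ua ic jc; rewrite -[a *+ i]mulr_natr -[a *+ j]mulr_natr.
by move=> /(mulrI ua) /(congr1 val) /=; rewrite !val_Zp_nat // !modn_small.
Qed.

Lemma unit_mulrn_surj (c : nat) (a b : 'Z_c) :
  (1 < c)%N -> a \is a GRing.unit -> exists2 t : nat, (t < c)%N & b = a *+ t.
Proof.
move=> c1 ua; exists (val (a^-1 * b)).
  by rewrite -[X in (_ < X)%N](Zp_cast c1) ltn_ord.
by rewrite -mulr_natr natr_Zp mulVKr.
Qed.

Lemma card_units (c : nat) :
  (1 < c)%N -> #|[set f : 'Z_c | f \is a GRing.unit]| = totient c.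
Proof.
move=> c1; rewrite -card_units_Zp ?(ltnW c1) // -(card_imset _ val_inj).
apply: eq_card => f; rewrite inE; apply/idP/imsetP => [uf | [u _ ->]].
  by exists (FinRing.unit 'Z_c uf); rewrite ?inE.
exact: valP u.
Qed.

Lemma progressionP (c : nat) (x f y : 'Z_c) (d : nat) :
  reflect (exists2 i : nat, (i < d)%N & y = x + f *+ i)
          (y \in progression x f d).
Proof.
apply: (iffP imsetP) => [[i _ ->] | [i id_ ->]]; first by exists i.
by exists (Ordinal id_).
Qed.

Lemma translate_progression (c : nat) (x f tau : 'Z_c) (d : nat) :
  translate (progression x f d) tau = progression (x + tau) f d.
Proof.
rewrite /translate /progression -imset_comp.
by apply: eq_imset => i /=; rewrite addrAC.
Qed.

Lemma progression_rev (c : nat) (x f : 'Z_c) (d : nat) :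
  progression x f d.+1 = progression (x + f *+ d) (- f) d.+1.
Proof.
apply/setP=> y; apply/progressionP/progressionP => -[i id_ ->];
  exists (d - i)%N; rewrite ?ltnS ?leq_subr //.
  by rewrite mulNrn -addrA -mulrnBr ?leq_subr // subKn.
by rewrite mulNrn -addrA -mulrnBr.
Qed.

Lemma card_progression_inj (c : nat) (x f : 'Z_c) (d : nat) (i j : nat) :
    #|progression x f d| = d -> (i < d)%N -> (j < d)%N ->
  f *+ i = f *+ j -> i = j.
Proof.
move=> cardP id_ jd eq_f.
have /imset_injP inj : #|progression x f d| == #|'I_d| by rewrite cardP card_ord.
have := inj (Ordinal id_) (Ordinal jd) isT isT.
by rewrite /= eq_f => /(_ erefl) [].
Qed.

Lemma card_progression_unit (c : nat) (x f : 'Z_c) (d : nat) :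
    (1 < c)%N -> f \is a GRing.unit -> (d <= c)%N ->
  #|progression x f d| = d.
Proof.
move=> c1 uf dc; rewrite card_imset ?card_ord // => i j /addrI eq_f.
apply: val_inj.
by apply: unit_mulrn_inj eq_f => //; apply: leq_trans (ltn_ord _) dc.
Qed.

(** Every term but the last is followed by another term, so that translation by
    the step has a single exit point. *)
Lemma progression_exit (c : nat) (x f y : 'Z_c) (d : nat) :
    y \in progression x f d -> y + f \notin progression x f d ->
  y + f = x + f *+ d.
Proof.
move=> /progressionP[i id_ ->] out; rewrite -addrA -mulrSr in out *.
have [ltid | ledi] := ltnP i.+1 d; last by congr (_ + _ *+ _); lia.
by case/progressionP: out; exists i.+1.
Qed.

Lemma generated_byP (c : nat) (A : {set 'Z_c}) (f : 'Z_c) (d : nat) :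
    (0 < d)%N -> #|A| = d ->
  reflect (exists x, A = progression x f d) (generated_by A f).
Proof.
move=> d0 cardA; rewrite /generated_by cardA.
apply: (iffP existsP) => [[x /andP[_ /eqP ->]] | [x defA]]; first by exists x.
exists x; rewrite defA eqxx andbT.
by apply/progressionP; exists 0%N; rewrite // mulr0n addr0.
Qed.

(** Writing [b] as [a *+ t] with [2 <= t <= c - 2], the terms of index [i] of
    the arc that translation by [b] pushes out are those with
    [d <= i + t < c]; there are at least two of them, whereas a progression of
    step [b] has only one exit. *)
Lemma generator_of_arc (c : nat) (a b x y : 'Z_c) (d : nat) :
    (1 < d)%N -> (d < c - 1)%N -> a \is a GRing.unit ->
    progression x a d = progression y b d ->
  [\/ b = 0, b = a | b = - a].
Proof.
move=> d1 dc ua eqAB; have c1 : (1 < c)%N by lia.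
have [t tc def_b] := unit_mulrn_surj _ a b c1 ua.
have [t0 | t_neq0] := eqVneq t 0%N.
  by constructor 1; rewrite def_b t0.
have [t1 | t_neq1] := eqVneq t 1%N.
  by constructor 2; rewrite def_b t1.
have [tm | t_neqm] := eqVneq t.+1 c.
  constructor 3; apply/eqP; rewrite -addr_eq0 def_b -mulrSr tm.
  by rewrite -mulr_natr pchar_Zp // mulr0.
have exit (i : nat) : (i < d)%N -> (d <= i + t)%N -> (i + t < c)%N ->
    x + a *+ (i + t) = y + b *+ d.
  move=> id_ dit itc; rewrite mulrnDr addrA -def_b.
  apply: progression_exit; rewrite -eqAB; first by apply/progressionP; exists i.
  apply/progressionP => -[j jd]; rewrite def_b -addrA -mulrnDr => /addrI.
  have jc : (j < c)%N by lia.
  by move/(unit_mulrn_inj _ _ _ _ c1 ua itc jc); lia.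
(* The truncated difference d - t is the least index that exits. *)
have : x + a *+ (d - t + t) = x + a *+ ((d - t).+1 + t).
  by rewrite !exit //; lia.
by move=> /addrI /(unit_mulrn_inj _ _ _ _ c1 ua); lia.
Qed.

Lemma generator_pm (c : nat) (a b x y : 'Z_c) (d : nat) :
    (1 < d)%N -> (d < c - 1)%N -> a \is a GRing.unit ->
    progression x a d = progression y b d ->
  b = a \/ b = - a.
Proof.
move=> d1 dc ua eqAB.
have [b0 | -> | ->] := generator_of_arc _ _ _ _ _ _ d1 dc ua eqAB;
  [| by left | by right].
have cardP : #|progression y b d| = d.
  by rewrite -eqAB card_progression_unit //; lia.
have := card_progression_inj _ _ _ _ 0 1 cardP (ltnW d1) d1.
by rewrite b0 => /(_ erefl).
Qed.

Lemma generators_arc (c d : nat) (A : {set 'Z_c}) (a : 'Z_c) :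
    (1 < d)%N -> (d < c - 1)%N -> #|A| = d -> a \is a GRing.unit ->
    generated_by A a ->
  generators A = [set a; - a].
Proof.
move=> d1 dc cardA ua gen_a; have d0 := ltnW d1.
have [x defA] := generated_byP _ _ _ _ d0 cardA gen_a.
apply/setP=> f; rewrite !inE.
apply/(generated_byP _ _ _ _ d0 cardA)/orP => [[y] | [/eqP-> | /eqP->]].
- rewrite defA => /(generator_pm _ _ _ _ _ _ d1 dc ua).
  by case=> ->; rewrite eqxx; [left | right].
- by exists x.
- by exists (x + a *+ d.-1); rewrite defA -(prednK d0) progression_rev.
Qed.

(** With [g = gcdn c f > 1], the multiple [f *+ (c %/ g)] vanishes, so the
    terms repeat after at most [c / 2] steps; this is fewer than [d]. *)
Lemma unit_of_card_progression (c : nat) (x f : 'Z_c) (d : nat) :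
    (1 < d)%N -> (c - 1 <= d <= c)%N -> #|progression x f d| = d ->
  f \is a GRing.unit.
Proof.
move=> d1 cd cardP; have c1 : (1 < c)%N by lia.
rewrite -(natr_Zp f) unitZpE //; apply: contraT => not_cop.
set g := gcdn c f; have g1 : (1 < g)%N.
  have g0 : (0 < g)%N by rewrite gcdn_gt0 (ltnW c1).
  by rewrite ltn_neqAle eq_sym not_cop.
have def_c : (c %/ g * g)%N = c by rewrite divnK ?dvdn_gcdl.
have : f *+ (c %/ g) = f *+ 0.
  rewrite -[in LHS](natr_Zp f) -(divnK (dvdn_gcdr c f)) -/g.
  by rewrite -mulrnA -mulnA (mulnC g) def_c mulnC mulrnA pchar_Zp // mul0rn.
have kd : (c %/ g < d)%N by nia.
by move/(card_progression_inj _ _ _ _ _ _ cardP kd (ltnW d1)); lia.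
Qed.

Lemma generators_large (c d : nat) (A : {set 'Z_c}) :
    (1 < d)%N -> d = (c - 1)%N \/ d = c -> #|A| = d ->
  generators A = [set f | f \is a GRing.unit].
Proof.
move=> d1 cd cardA; have d0 := ltnW d1; have c1 : (1 < c)%N by lia.
have dc : (d <= c)%N by lia.
have cardZ : #|'Z_c| = c by rewrite card_ord Zp_cast.
apply/setP=> f; rewrite !inE.
apply/(generated_byP _ _ _ _ d0 cardA)/idP => [[x defA] | uf].
  by apply: (unit_of_card_progression _ x _ _ d1); [lia | rewrite -defA].
suff [x sub] : exists x, progression x f d \subset A.
  by exists x; apply/esym/eqP; rewrite eqEcard sub cardA card_progression_unit /=.
case: cd => [dE | dE].
- have /cards1P[z defC] : #|~: A| == 1%N by rewrite cardsCs setCK cardZ cardA; lia.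
  exists (z + f); apply/subsetP=> y /progressionP[i id_ ->].
  rewrite -[_ \in A]negbK -in_setC defC inE -addrA -mulrS.
  (* Returning to z would take c steps, and the index i + 1 is below c. *)
  apply/eqP; rewrite -[RHS]addr0 => /addrI; rewrite -(mulr0n f).
  by move/(unit_mulrn_inj _ _ _ _ c1 uf); lia.
- have -> : A = setT by apply/eqP; rewrite eqEcard subsetT cardsT cardZ cardA dE /=.
  by exists 0; apply: subsetT.
Qed.

Theorem theorem1 (c d : nat) :
  ((1 < d)%N -> (d < c - 1)%N ->
     (forall a b : 'Z_c,
        coprime_elt a \/ coprime_elt b ->
        #|progression 0 a d| = d ->
        #|progression 0 b d| = d ->
        (exists tau : 'Z_c,
           progression 0 a d = translate (progression 0 b d) tau) ->
        a = b \/ a = - b)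
     /\
     (forall (A : {set 'Z_c}) (a : 'Z_c),
        #|A| = d -> coprime_elt a -> generated_by A a ->
        generators A = [set a; - a]))
  /\
  ((1 < d)%N -> d = (c - 1)%N \/ d = c ->
     forall A : {set 'Z_c},
       #|A| = d ->
       (exists2 f : 'Z_c, coprime_elt f & generated_by A f) ->
       #|generators A| = totient c).
Proof.
split=> [d1 dc | d1 cd A cardA _]; have c1 : (1 < c)%N by lia.
  split=> [a b cop _ _ [tau] | A a cardA /(coprime_elt_unit _ _ c1) ua].
    rewrite translate_progression => eqAB.
    case: cop => /(coprime_elt_unit _ _ c1) u.
      case: (generator_pm _ _ _ _ _ _ d1 dc u eqAB) => ->; first by left.
      by right; rewrite opprK.
    exact: generator_pm _ _ _ _ _ _ d1 dc u (esym eqAB).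
  exact: generators_arc d1 dc cardA ua.
by rewrite (generators_large _ _ _ d1 cd cardA) card_units.
Qed.
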